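(* Let $A\in\mathbb{R}^{n\times n}$ be symmetric positive definite with eigenvalues $\lambda_1,\dots,\lambda_n$ (counted with multiplicity), and let $C\in\mathbb{R}^{n\times n}$ be symmetric negative definite. Then the unique solution $X\in\mathbb{R}^{n\times n}$ to the Lyapunov equation $AX+XA^T=-C$ is symmetric positive definite and satisfies $$1\le \kappa_2(X)\le 2\,\kappa_2(C)\,\lambda_{\max}(A)\,\max_{1\le i\le n}\sum_{j=1}^n\frac{1}{\lambda_i+\lambda_j}\le n\,\kappa_2(A)\,\kappa_2(C).$$
   Context: For a nonsingular matrix $M$, $\kappa_2(M)=\|M\|_2\|M^{-1}\|_2$ is the spectral condition number (ratio of largest to smallest singular value). $\lambda_{\max}(A)$ denotes the largest eigenvalue of the symmetric matrix $A$. *)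

(* Defs.v *)
From HB Require Import structures.
From mathcomp Require Export all_boot all_order all_algebra.
From mathcomp Require Export all_classical all_reals.
Set Implicit Arguments.
Unset Strict Implicit.
Unset Printing Implicit Defensive.
Import Order.TTheory GRing.Theory Num.Theory.
Local Open Scope classical_set_scope.
Local Open Scope ring_scope.

Definition sym_posdef (R : realType) (n : nat) (M : 'M[R]_n) : Prop :=
  M \is symmetricmx /\
  forall x : 'cV[R]_n, x != 0 -> 0 < (x^T *m M *m x) 0 0.

Definition sym_negdef (R : realType) (n : nat) (M : 'M[R]_n) : Prop :=
  M \is symmetricmx /\
  forall x : 'cV[R]_n, x != 0 -> (x^T *m M *m x) 0 0 < 0.

Definition norm2 (R : realType) (n : nat) (x : 'cV[R]_n) : R :=
  Num.sqrt (\sum_(i < n) x i 0 ^+ 2).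

(* For n > 0 the set is nonempty and bounded, so sup is a genuine supremum;
   for n = 0 it is empty and the value is 0. *)
Definition specnorm (R : realType) (n : nat) (M : 'M[R]_n) : R :=
  sup [set norm2 (M *m x) | x in [set x : 'cV[R]_n | norm2 x = 1]].

(* Meaningful for M \in unitmx only: invmx M = M when M is singular. *)
Definition kappa2 (R : realType) (n : nat) (M : 'M[R]_n) : R :=
  specnorm M * specnorm (invmx M).

(* For n > 0 and M symmetric the set of real eigenvalues is finite and
   nonempty, so this supremum is a maximum. *)
Definition lambda_max (R : realType) (n : nat) (M : 'M[R]_n) : R :=
  sup [set a : R | eigenvalue M a].

Definition eigenvalues_with_mult (R : realType) (n : nat) (M : 'M[R]_n)
    (lam : 'I_n -> R) : Prop :=
  char_poly M = \prod_(i < n) ('X - (lam i)%:P).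

(* Main.v *)
(* If X solves the Lyapunov equation and X v = xi v with v != 0, then pairing
   the equation with v gives 2 xi (v^T A v) = v^T (- C) v.  With a1 <= a2 and
   c1 <= c2 the extreme eigenvalues of A and of - C, every eigenvalue of X thus
   lies in [c1 / (2 a2), c2 / (2 a1)], so that
   kappa2 X <= (c2 / c1) * (a2 / a1); the maximal row sum in the theorem is
   between 1 / (2 a1), from its diagonal term at lam i = a1, and n / (2 a1).
   Only extreme eigenvectors are needed: they come from the supremum mu of the
   Rayleigh quotient, because mu - M is positive semidefinite and cannot be
   invertible. *)
Require Import Defs.
From HB Require Import structures.
From mathcomp Require Import all_boot all_order all_algebra.
From mathcomp Require Import all_classical all_reals.
From mathcomp Require Import ring lra.
Import Order.TTheory GRing.Theory Num.Theory.
Local Open Scope ring_scope.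

Definition bform {R : realType} {n : nat} (M : 'M[R]_n) (x y : 'cV[R]_n) : R :=
  (x^T *m M *m y) 0 0.

Local Notation dot := (bform 1%:M).

(** An eigenvector together with the Rayleigh bound: this pair replaces a full diagonalization
    everywhere below. *)
Definition least_eig {R : realType} {n : nat} (M : 'M[R]_n) (a : R) : Prop :=
  (exists2 v : 'cV[R]_n, v != 0 & M *m v = a *: v) /\
  forall x, a * dot x x <= bform M x x.

Definition greatest_eig {R : realType} {n : nat} (M : 'M[R]_n) (a : R) : Prop :=
  (exists2 v : 'cV[R]_n, v != 0 & M *m v = a *: v) /\
  forall x, bform M x x <= a * dot x x.

(** * Bilinear forms and Cauchy-Schwarz inequalities *)

Section BilinearForm.
Set Implicit Arguments.
Unset Strict Implicit.
Context {R : realType} {n : nat}.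
Implicit Types (M N : 'M[R]_n) (x y z : 'cV[R]_n).

Lemma symmetricmx_tr M : M \is symmetricmx <-> M^T = M.
Proof.
rewrite is_hermitianmxE expr0 scale1r map_mx_id; split => [/eqP <-|->] //.
Qed.

Lemma bformDr M x y z : bform M x (y + z) = bform M x y + bform M x z.
Proof. by rewrite /bform mulmxDr mxE. Qed.

Lemma bformZr M x c y : bform M x (c *: y) = c * bform M x y.
Proof. by rewrite /bform -scalemxAr mxE. Qed.

Lemma bformDl M x y z : bform M (x + y) z = bform M x z + bform M y z.
Proof. by rewrite /bform linearD /= !mulmxDl mxE. Qed.

Lemma bformZl M c x y : bform M (c *: x) y = c * bform M x y.
Proof. by rewrite /bform linearZ /= -!scalemxAl mxE. Qed.

Lemma bformDm M N x y : bform (M + N) x y = bform M x y + bform N x y.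
Proof. by rewrite /bform mulmxDr mulmxDl mxE. Qed.

Lemma bformNm M x y : bform (- M) x y = - bform M x y.
Proof. by rewrite /bform mulmxN mulNmx mxE. Qed.

Lemma bform_scalar c x y : bform c%:M x y = c * dot x y.
Proof. by rewrite /bform mul_mx_scalar mulmx1 -scalemxAl mxE. Qed.

Lemma bform_mulmxr M N x y : bform M x (N *m y) = bform (M *m N) x y.
Proof. by rewrite /bform !mulmxA. Qed.

Lemma bform_mulmxl M N x y : bform M (N *m x) y = bform (N^T *m M) x y.
Proof. by rewrite /bform trmx_mul !mulmxA. Qed.

Lemma bform_trmx M x y : bform M^T x y = bform M y x.
Proof.
have -> : bform M y x = (y^T *m M *m x)^T 0 0 by rewrite mxE.
by rewrite !trmx_mul trmxK mulmxA.
Qed.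

Lemma bformC M x y : M^T = M -> bform M x y = bform M y x.
Proof. by move=> Ms; rewrite -bform_trmx Ms. Qed.

Lemma dotE x : dot x x = \sum_i x i 0 ^+ 2.
Proof.
by rewrite /bform mulmx1 mxE; apply: eq_bigr => i _; rewrite mxE expr2.
Qed.

Lemma dot_ge0 x : 0 <= dot x x.
Proof. by rewrite dotE sumr_ge0 // => i _; rewrite sqr_ge0. Qed.

Lemma dot_gt0 x : x != 0 -> 0 < dot x x.
Proof.
move=> x0; rewrite lt_neqAle dot_ge0 andbT eq_sym.
apply: contraNneq x0 => /eqP; rewrite dotE psumr_eq0; last first.
  by move=> i _; rewrite sqr_ge0.
move=> /allP h; apply/eqP/matrixP => i j; rewrite ord1 mxE.
by apply/eqP; rewrite -sqrf_eq0; apply: h; rewrite mem_index_enum.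
Qed.

Lemma norm2E x : norm2 x = Num.sqrt (dot x x).
Proof. by rewrite dotE. Qed.

Lemma bform_bounded M :
  exists2 K : R, 0 < K & forall x, bform M x x <= K * dot x x.
Proof.
(* The [+ 1] makes the constant positive even for [M = 0], so that it can be inverted. *)
exists (\sum_i \sum_j `|M i j| + 1) => [|x].
  by rewrite ltr_wpDl // !sumr_ge0 // => i _; rewrite sumr_ge0.
have xi_le i : x i 0 ^+ 2 <= dot x x.
  by rewrite dotE (bigD1 i) //= lerDl sumr_ge0 // => j _; rewrite sqr_ge0.
rewrite mulrDl mul1r; apply: ler_wpDr; first exact: dot_ge0.
set d := dot x x in xi_le *; rewrite /bform -mulmxA mxE mulr_suml.
apply: ler_sum => i _.
rewrite !mxE mulr_sumr mulr_suml; apply: ler_sum => j _.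
apply: (le_trans (ler_norm _)); rewrite mulrCA normrM.
apply: ler_wpM2l => //.
(* Both signs of $|x_i x_j| \le |x|^2$ come from $(x_i \pm x_j)^2 \ge 0$. *)
rewrite ler_norml; have := xi_le i; have := xi_le j => hj hi.
by apply/andP; split; have := sqr_ge0 (x i 0 + x j 0);
  have := sqr_ge0 (x i 0 - x j 0); nra.
Qed.

(** The polynomial $t \mapsto (x + ty)^T M (x + ty)$ is nonnegative. As [M] is only semidefinite,
    its leading coefficient may vanish. *)
Lemma psd_cauchy_schwarz M x y : M^T = M -> (forall z, 0 <= bform M z z) ->
  bform M x y ^+ 2 <= bform M x x * bform M y y.
Proof.
move=> Ms Mpsd.
have h t : 0 <= bform M x x + 2 * t * bform M x y + t ^+ 2 * bform M y y.
  have := Mpsd (x + t *: y).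
  rewrite bformDl !bformDr !bformZl !bformZr (bformC y x) //.
  by congr (_ <= _); ring.
have := Mpsd y; rewrite le_eqVlt => /orP[/eqP c0|c0].
  have [->|b0] := eqVneq (bform M x y) 0.
    by rewrite expr0n /= mulr_ge0.
  (* The polynomial is now affine with nonzero slope; at this $t$ it takes the value $-1$. *)
  have := h (- (bform M x x + 1) / (2 * bform M x y)).
  rewrite -c0 mulr0 addr0.
  have -> : bform M x x + 2 * (- (bform M x x + 1) / (2 * bform M x y))
     * bform M x y = -1 by field; rewrite b0.
  by rewrite ler0N1.
(* The minimizer of the quadratic. *)
have := h (- bform M x y / bform M y y).
have -> : bform M x x + 2 * (- bform M x y / bform M y y) * bform M x y
   + (- bform M x y / bform M y y) ^+ 2 * bform M y y
   = bform M x x - bform M x y ^+ 2 / bform M y y.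
  by field; rewrite gt_eqF.
by rewrite subr_ge0 ler_pdivrMr.
Qed.

Lemma cauchy_schwarz x y : dot x y ^+ 2 <= dot x x * dot y y.
Proof. by apply: psd_cauchy_schwarz; [rewrite trmx1 | exact: dot_ge0]. Qed.

(* Cauchy-Schwarz for M applied to x and M^-1 x. *)
Lemma psd_coercive M : M^T = M -> (forall z, 0 <= bform M z z) ->
  M \in unitmx ->
  exists2 c : R, 0 < c & forall x, c * dot x x <= bform M x x.
Proof.
move=> Ms Mpsd Mu; have [K K0 hK] := bform_bounded (invmx M).
exists K^-1 => [|x]; first by rewrite invr_gt0.
have [->|x0] := eqVneq x 0; first by rewrite -(scale0r 0) !bformZl !mul0r mulr0.
have := psd_cauchy_schwarz x (invmx M *m x) Ms Mpsd.
rewrite bform_mulmxr mulmxV // bform_mulmxr bform_mulmxl mulmxV //.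
rewrite mulmx1 bform_trmx => h.
rewrite ler_pdivrMl // -(ler_pM2r (dot_gt0 x0)) -expr2.
by apply: le_trans h _; rewrite mulrAC [leRHS]mulrC ler_wpM2l // hK.
Qed.

(** * Extreme eigenvalues from the Rayleigh quotient *)

Lemma rayleigh_max M : (0 < n)%N -> M^T = M -> exists a, greatest_eig M a.
Proof.
move=> n0 Ms; pose E := [set bform M x x | x in [set x | dot x x = 1]]%classic.
have [K K0 hK] := bform_bounded M.
have Eub : has_ubound E by exists K => _ [x /= x1 <-]; have := hK x; rewrite x1 mulr1.
have E0 : (E !=set0)%classic.
  pose e : 'cV[R]_n := delta_mx (Ordinal n0) 0.
  exists (bform M e e), e => //=.
  rewrite dotE (bigD1 (Ordinal n0)) //= big1 ?addr0 => [|i ni].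
    by rewrite mxE !eqxx expr1n.
  by rewrite mxE (negbTE ni) expr0n.
have quot x : bform M x x <= sup E * dot x x.
  have [->|x0] := eqVneq x 0; first by rewrite -(scale0r 0) !bformZl !mul0r mulr0.
  have d0 := dot_gt0 x0.
  rewrite -ler_pdivrMr //; apply: ub_le_sup => //.
  exists ((Num.sqrt (dot x x))^-1 *: x); rewrite /= bformZl bformZr mulrA -expr2.
    by rewrite exprVn sqr_sqrtr ?mulVf ?gt_eqF ?dot_ge0.
  by rewrite exprVn sqr_sqrtr ?dot_ge0 // mulrC.
exists (sup E); split => //.
pose N := (sup E)%:M - M.
have NE x : bform N x x = sup E * dot x x - bform M x x.
  by rewrite bformDm bformNm bform_scalar.
have Ns : N^T = N by rewrite linearB /= Ms tr_scalar_mx.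
(* If [N] were invertible, coercivity with constant [c] would make [sup E - c] an upper bound of
   [E]. *)
have [Nu|] := boolP (N \in unitmx).
  have [x|c c0 hc] := psd_coercive Ns _ Nu; first by rewrite NE subr_ge0.
  have : sup E <= sup E - c.
    apply: ge_sup => // _ [x /= x1 <-].
    by have := hc x; rewrite NE x1; lra.
  by rewrite lerBrDr gerDl leNgt c0.
(* The kernel vector is a row; since [N] is symmetric, its transpose is an eigenvector of [M]. *)
rewrite unitmxE unitfE negbK => /det0P[v v0 vN].
exists v^T; first by rewrite trmx_eq0.
have := congr1 trmx vN; rewrite trmx_mul Ns trmx0 mulmxBl => /eqP.
by rewrite subr_eq0 mul_scalar_mx => /eqP.
Qed.

Lemma rayleigh_min M : (0 < n)%N -> M^T = M -> exists a, least_eig M a.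
Proof.
move=> n0 Ms; have [|a [[v v0 va] ha]] := @rayleigh_max (- M) n0.
  by rewrite linearN /= Ms.
exists (- a); split => [|x].
  by exists v => //; rewrite scaleNr -va mulNmx opprK.
by have := ha x; rewrite bformNm; lra.
Qed.

Lemma bform_eigenvector M a x : M *m x = a *: x -> bform M x x = a * dot x x.
Proof. by move=> xa; rewrite -[M in LHS]mul1mx -bform_mulmxr xa bformZr. Qed.

Lemma least_eig_gt0 M a :
  (forall x : 'cV[R]_n, x != 0 -> 0 < bform M x x) -> least_eig M a -> 0 < a.
Proof.
move=> Mpd [[v v0 va] _]; have := Mpd v v0.
by rewrite (bform_eigenvector va) pmulr_lgt0 // dot_gt0.
Qed.

(** * Spectral norm and condition number *)

Lemma specnorm_attained M b : 0 <= b ->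
  (forall x, dot (M *m x) (M *m x) <= b ^+ 2 * dot x x) ->
  (exists2 v : 'cV[R]_n, v != 0 & M *m v = b *: v) -> specnorm M = b.
Proof.
move=> b0 hb [v v0 vb].
have ub : ubound [set norm2 (M *m x) | x in [set x | norm2 x = 1]]%classic b.
  move=> _ [x /= + <-]; rewrite !norm2E => x1.
  rewrite -(ger0_norm b0) -sqrtr_sqr ler_sqrt ?sqr_ge0 //.
  apply: le_trans (hb x) _.
  by rewrite -[dot x x]sqr_sqrtr ?dot_ge0 // x1 expr1n mulr1.
have inE : [set norm2 (M *m x) | x in [set x | norm2 x = 1]]%classic b.
  have d0 := dot_gt0 v0.
  have u1 : dot ((Num.sqrt (dot v v))^-1 *: v) ((Num.sqrt (dot v v))^-1 *: v) = 1.
    rewrite bformZl bformZr mulrA -expr2.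
    by rewrite exprVn sqr_sqrtr ?mulVf ?gt_eqF ?dot_ge0.
  exists ((Num.sqrt (dot v v))^-1 *: v); rewrite /= norm2E ?u1 ?sqrtr1 //.
  rewrite -scalemxAr vb scalerA mulrC -scalerA bformZl bformZr u1 mulr1 -expr2.
  by rewrite sqrtr_sqr ger0_norm.
apply/eqP; rewrite eq_le; apply/andP; split.
  by apply: ge_sup => //; exists b.
by apply: ub_le_sup => //; exists b.
Qed.

Lemma least_eig_unitmx M a : 0 < a -> least_eig M a -> M \in unitmx.
Proof.
move=> a0 [_ ha]; rewrite unitmxE unitfE; apply/negP => /det0P[w w0 wM].
have := ha w^T; rewrite {2}/bform trmxK wM mul0mx mxE leNgt.
by rewrite mulr_gt0 // dot_gt0 // trmx_eq0.
Qed.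

(** The norms of [M] and [invmx M] are $b$ and $1/a$: each bound is a Cauchy-Schwarz inequality, and
    the extreme eigenvectors attain them. *)
Lemma kappa2_posdef M a b : M^T = M -> 0 < a -> least_eig M a ->
  greatest_eig M b -> kappa2 M = b / a.
Proof.
move=> Ms a0 mM [[v v0 vb] hb]; have [[u u0 ua] ha] := mM.
have Mpsd x : 0 <= bform M x x.
  by apply: le_trans _ (ha x); rewrite mulr_ge0 ?dot_ge0 // ltW.
have ab : a <= b.
  by have := ha v; rewrite (bform_eigenvector vb) ler_pM2r // dot_gt0.
have Mu := least_eig_unitmx a0 mM.
have b0 : 0 < b by exact: lt_le_trans ab.
have dotM x y : dot x (M *m y) = bform M x y by rewrite bform_mulmxr mul1mx.
rewrite /kappa2; congr (_ * _); apply: specnorm_attained.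
- exact: ltW.
- move=> x; have [Mx0|Mx0] := eqVneq (M *m x) 0.
    by rewrite Mx0 -(scale0r 0) bformZl mul0r mulr_ge0 ?sqr_ge0 ?dot_ge0.
  (* $|Mx|^4 = (x^T M (Mx))^2 \le (x^T M x)\,((Mx)^T M (Mx)) \le b^2 |x|^2 |Mx|^2$. *)
  rewrite -(ler_pM2r (dot_gt0 Mx0)) -expr2.
  rewrite {1}dotM (bformC _ x) //.
  apply: le_trans (psd_cauchy_schwarz x (M *m x) Ms Mpsd) _.
  apply: le_trans (ler_pM (Mpsd _) (Mpsd _) (hb _) (hb _)) _.
  by rewrite mulrACA -expr2 mulrA.
- by exists v.
- by rewrite invr_ge0 ltW.
(* With $y = Mx$ the claim is $a|x| \le |Mx|$, which follows from $a|x|^2 \le x^T M x \le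
   |x|\,|Mx|$. *)
- move=> y; pose x := invmx M *m y.
  have -> : y = M *m x by rewrite mulKVmx.
  rewrite mulKmx // exprVn ler_pdivlMl ?exprn_gt0 //.
  have [->|x0] := eqVneq x 0.
    by rewrite mulmx0 -(scale0r 0) !bformZl !mul0r mulr0.
  rewrite -(ler_pM2r (dot_gt0 x0)) [leRHS]mulrC.
  apply: le_trans _ (cauchy_schwarz x (M *m x)).
  rewrite dotM -mulrA -expr2 -exprMn ler_sqr ?nnegrE ?ha //.
  by rewrite mulr_ge0 ?dot_ge0 // ltW.
- exists u => //; apply: (can_inj (mulKmx Mu)).
  by rewrite mulKVmx // -scalemxAr ua scalerA mulVf ?scale1r // gt_eqF.
Qed.

(** Carries the value found for the positive definite $-C$ over to $C$. *)
Lemma kappa2N M : M \in unitmx -> kappa2 (- M) = kappa2 M.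
Proof.
have specN N : specnorm (- N) = specnorm N.
  congr sup; apply: eq_imagel => x _; rewrite !norm2E mulNmx -scaleN1r.
  by rewrite bformZl bformZr mulrA mulrNN mulr1 mul1r.
move=> Mu; rewrite /kappa2 specN -scaleN1r invmxZ.
  by rewrite invrN1 scaleN1r specN.
by rewrite unitmxE detZ unitrM unitrX ?unitrN1.
Qed.

(** * Link with the eigenvalues of the statement *)

(** [eigenvalue] is about row eigenvectors; symmetry turns them into columns by transposition. *)
Lemma eigenvalue_symP M a : M^T = M ->
  (exists2 v : 'cV[R]_n, v != 0 & M *m v = a *: v) <-> eigenvalue M a.
Proof.
move=> Ms; split=> [[v v0 va]|/eigenvalueP[v va v0]].
  apply/eigenvalueP; exists v^T; last by rewrite trmx_eq0.
  by rewrite -[in LHS]Ms -trmx_mul va linearZ.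
exists v^T; first by rewrite trmx_eq0.
by rewrite -[in LHS]Ms -trmx_mul va linearZ.
Qed.

Lemma lambda_max_greatest M b : M^T = M -> greatest_eig M b -> lambda_max M = b.
Proof.
move=> Ms [/(eigenvalue_symP _ Ms) eb hb].
have ub : ubound [set a | eigenvalue M a]%classic b.
  move=> a /= /(eigenvalue_symP _ Ms)[v v0 va].
  by have := hb v; rewrite (bform_eigenvector va) ler_pM2r // dot_gt0.
apply/eqP; rewrite eq_le; apply/andP; split.
  by apply: ge_sup => //; exists b.
by apply: ub_le_sup => //; exists b.
Qed.

Lemma eigenvalues_with_multP M lam a : eigenvalues_with_mult M lam ->
  eigenvalue M a <-> exists i, lam i = a.
Proof.
rewrite eigenvalue_root_char => ->; rewrite /root horner_prod.
split=> [/prodf_eq0[i _]|[i <-]].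
  by rewrite hornerXsubC subr_eq0 => /eqP ->; exists i.
by apply/prodf_eq0; exists i => //; rewrite hornerXsubC subrr.
Qed.

End BilinearForm.

(** * The Lyapunov equation *)

Section Lyapunov.
Set Implicit Arguments.
Unset Strict Implicit.
Context {R : realType} {n : nat} (A : 'M[R]_n).
Hypotheses (As : A^T = A) (Apd : forall x : 'cV[R]_n, x != 0 -> 0 < bform A x x).

(* X^T A X = - (X^T X) A, and both X^T A X and X A X^T have nonnegative trace. *)
Lemma lyapunov_ker (X : 'M[R]_n) : A *m X + X *m A = 0 -> X = 0.
Proof.
move=> /eqP; rewrite addr_eq0 => /eqP AX.
have Apsd x : 0 <= bform A x x.
  by have [->|/Apd/ltW//] := eqVneq x 0; rewrite -(scale0r 0) bformZl mul0r.
have diagE (Y : 'M[R]_n) i : (Y^T *m A *m Y) i i = bform A (col i Y) (col i Y).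
  rewrite /bform tr_col -!row_mul [RHS]mxE [LHS]mxE [RHS]mxE.
  by apply: eq_bigr => k _; rewrite [col _ _ _ _]mxE.
have tr_ge0 (Y : 'M[R]_n) : 0 <= \tr (Y^T *m A *m Y).
  by apply: sumr_ge0 => i _; rewrite diagE.
have tr0 : \tr (X^T *m A *m X) = 0.
  apply/eqP; rewrite eq_le tr_ge0 andbT -mulmxA AX mulmxN linearN /= oppr_le0.
  by have := tr_ge0 X^T; rewrite trmxK mxtrace_mulC.
apply/matrixP => i j.
(* A zero trace with nonnegative diagonal entries forces each entry to vanish; the [j]-th one is the
   form of [A] at column [j] of [X]. *)
have : col j X = 0.
  apply/eqP/contraT => /Apd; rewrite -diagE.
  move: tr0 => /eqP; rewrite psumr_eq0 => [|k _]; last by rewrite diagE.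
  by move=> /allP/(_ j (mem_index_enum _))/eqP ->; rewrite ltxx.
by move=> /matrixP/(_ i 0); rewrite !mxE.
Qed.

(** The Lyapunov operator is an injective linear endomorphism of a finite-dimensional space, hence
    bijective; [lin_mx] is its matrix on vectorized matrices. *)
Lemma lyapunov_unique (P : 'M[R]_n) : exists! X, A *m X + X *m A = P.
Proof.
pose L X := A *m X + X *m A.
have Llin : linear L.
  move=> c X Y; rewrite /L mulmxDr mulmxDl -scalemxAr -scalemxAl scalerDr.
  by rewrite addrACA.
pose HL := GRing.isLinear.Build _ _ _ _ L Llin.
pose f : {linear 'M[R]_n -> 'M[R]_n} := HB.pack L HL.
have fu : lin_mx f \in unitmx.
  rewrite -row_free_unit -kermx_eq0; apply/rowV0P => v /sub_kermxP vf.
  have : f (vec_mx v) = 0 by rewrite -mx_rV_lin vf linear0.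
  by move=> /lyapunov_ker v0; rewrite -[v]vec_mxK v0 linear0.
exists (vec_mx (mxvec P *m invmx (lin_mx f))); split=> [|Y YP].
  by rewrite -[LHS]/(f _) -mx_rV_lin mulmxKV // mxvecK.
have -> : P = f Y by [].
by rewrite -mul_vec_lin mulmxK // mxvecK.
Qed.

(** The transpose of [X] solves the same equation, so the difference lies in the trivial kernel. *)
Lemma lyapunov_sym (P X : 'M[R]_n) :
  P^T = P -> A *m X + X *m A = P -> X^T = X.
Proof.
move=> Ps XP; apply/eqP; rewrite -subr_eq0; apply/eqP/lyapunov_ker.
have XtP : A *m X^T + X^T *m A = P.
  by rewrite -[RHS]Ps -XP linearD /= !trmx_mul As addrC.
by rewrite mulmxBr mulmxBl addrACA -opprD XP XtP subrr.
Qed.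

(** In $v^T A X v$ the matrix [X] acts on the right [v], in $v^T X A v$ by symmetry on the left one;
    each term gives $x\, v^T A v$. *)
Lemma lyapunov_eigenvector (P X : 'M[R]_n) x v : X^T = X ->
  A *m X + X *m A = P -> X *m v = x *: v ->
  2 * x * bform A v v = bform P v v.
Proof.
move=> Xs <- vx; rewrite bformDm -bform_mulmxr -{2}Xs -bform_mulmxl vx.
by rewrite bformZl bformZr; ring.
Qed.

End Lyapunov.

(** * Bounds on the maximal row sum *)

Section MaxRowSum.
Set Implicit Arguments.
Unset Strict Implicit.
Context {R : realType} {n : nat} (lam : 'I_n -> R) (a : R).
Hypotheses (a_gt0 : 0 < a) (a_le : forall i, a <= lam i).
Local Notation max_row_sum :=
  (\big[Num.max/0]_(i < n) \sum_(j < n) (lam i + lam j)^-1).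

Lemma max_row_sum_ge i0 : lam i0 = a -> (2 * a)^-1 <= max_row_sum.
Proof.
move=> i0a.
apply: le_trans _ (le_bigmax 0 (fun i => \sum_j (lam i + lam j)^-1) i0).
rewrite (bigD1 i0) //= i0a -[a + a]mulr2n -[a *+ 2]mulr_natl lerDl sumr_ge0 // => j _.
by rewrite invr_ge0 addr_ge0 ?(le_trans (ltW a_gt0)).
Qed.

Lemma max_row_sum_le : max_row_sum <= n%:R * (2 * a)^-1.
Proof.
have a2 : 0 < 2 * a by rewrite mulr_gt0.
apply: bigmax_le => [|i _]; first by rewrite mulr_ge0 // invr_ge0 ltW.
apply: (@le_trans _ _ (\sum_(j < n) (2 * a)^-1)).
  apply: ler_sum => j _; have := a_le i; have := a_le j => hj hi.
  by rewrite lef_pV2 ?posrE //; lra.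
by rewrite sumr_const card_ord [leRHS]mulr_natl.
Qed.

End MaxRowSum.

(* In the maximum below the seed 0 is harmless: the index set is nonempty and
   the eigenvalues of A are positive. *)
Theorem theorem1 (R : realType) (n : nat) (n_gt0 : (0 < n)%N)
    (A C : 'M[R]_n) (lam : 'I_n -> R)
    (A_pd : sym_posdef A) (A_eig : eigenvalues_with_mult A lam)
    (C_nd : sym_negdef C) :
  (exists! X : 'M[R]_n, A *m X + X *m A^T = - C) /\
  (forall X : 'M[R]_n, A *m X + X *m A^T = - C ->
     sym_posdef X /\
     [/\ 1 <= kappa2 X,
         kappa2 X <= 2 * kappa2 C * lambda_max A
           * \big[Num.max/0]_(i < n) \sum_(j < n) (lam i + lam j)^-1
       & 2 * kappa2 C * lambda_max A
           * \big[Num.max/0]_(i < n) \sum_(j < n) (lam i + lam j)^-1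
         <= n%:R * kappa2 A * kappa2 C]).
Proof.
case: A_pd => /symmetricmx_tr As Apd; case: C_nd => /symmetricmx_tr Cs Cnd.
rewrite As; split=> [|X XC]; first exact: lyapunov_unique.
have Ps : (- C)^T = - C by rewrite linearN /= Cs.
have Ppd x : x != 0 -> 0 < bform (- C) x x.
  by move=> /Cnd; rewrite bformNm oppr_gt0.
have Xs := lyapunov_sym As Apd Ps XC.
have [a1 mA] := rayleigh_min n_gt0 As.
have [a2 MA] := rayleigh_max n_gt0 As.
have [c1 mP] := rayleigh_min n_gt0 Ps.
have [c2 MP] := rayleigh_max n_gt0 Ps.
have [x1 mX] := rayleigh_min n_gt0 Xs.
have [x2 MX] := rayleigh_max n_gt0 Xs.
have a1_gt0 := least_eig_gt0 Apd mA.
have c1_gt0 := least_eig_gt0 Ppd mP.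
have [[u u0 ux] X_ge] := mX; have [[v v0 vx] X_le] := MX.
have du := dot_gt0 u0; have dv := dot_gt0 v0.
(* Any nonzero vector orders least and greatest eigenvalue; [u] serves for all three matrices. *)
have a12 : a1 <= a2.
  by rewrite -(ler_pM2r du); exact: le_trans (mA.2 u) (MA.2 u).
have c12 : c1 <= c2.
  by rewrite -(ler_pM2r du); exact: le_trans (mP.2 u) (MP.2 u).
have x12 : x1 <= x2.
  by rewrite -(ler_pM2r du); exact: le_trans (X_ge u) (X_le u).
have uE := lyapunov_eigenvector Xs XC ux.
have vE := lyapunov_eigenvector Xs XC vx.
have x1_gt0 : 0 < x1.
  by have := Ppd u u0; rewrite -uE pmulr_lgt0 ?Apd // pmulr_rgt0.
(* $c_1 |u|^2 \le u^T(-C)u = 2 x_1 u^T A u \le 2 x_1 a_2 |u|^2$; the next bound is its mirror image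
   at [v]. *)
have x1_ge : c1 <= 2 * x1 * a2.
  rewrite -(ler_pM2r du); apply: le_trans (mP.2 u) _; rewrite -uE -[leRHS]mulrA.
  by rewrite ler_wpM2l ?(MA.2 u) // mulr_ge0 // ltW.
have x2_le : 2 * x2 * a1 <= c2.
  rewrite -(ler_pM2r dv); apply: le_trans _ (MP.2 v); rewrite -vE -[leLHS]mulrA.
  by rewrite ler_wpM2l ?(mA.2 v) // mulr_ge0 // ltW // (lt_le_trans x1_gt0).
have a1_le i : a1 <= lam i.
  have /(eigenvalue_symP _ As)[w w0 wA] : eigenvalue A (lam i).
    by apply/(eigenvalues_with_multP _ A_eig); exists i.
  by have := mA.2 w; rewrite (bform_eigenvector wA) ler_pM2r // dot_gt0.
(* The least eigenvalue occurs in the list [lam]; its row has the diagonal term $1/(2a_1)$. *)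
have [i0 i0a] : exists i, lam i = a1.
  by apply/(eigenvalues_with_multP _ A_eig)/(eigenvalue_symP _ As); case: mA.
split.
  split=> [|x /dot_gt0 dx]; first exact/symmetricmx_tr.
  by apply: lt_le_trans (X_ge x); rewrite mulr_gt0.
have -> : kappa2 C = c2 / c1.
  by rewrite -[C]opprK kappa2N ?(kappa2_posdef Ps c1_gt0 mP MP) //
    (least_eig_unitmx c1_gt0 mP).
rewrite (kappa2_posdef Xs x1_gt0 mX MX) (kappa2_posdef As a1_gt0 mA MA).
rewrite (lambda_max_greatest As MA).
set S := \big[_/_]_(_ < _) _.
have S_ge : (2 * a1)^-1 <= S := max_row_sum_ge a1_gt0 a1_le i0a.
have S_le : S <= n%:R * (2 * a1)^-1 := max_row_sum_le a1_gt0 a1_le.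
have c2_gt0 : 0 < c2 := lt_le_trans c1_gt0 c12.
have a2_gt0 : 0 < a2 := lt_le_trans a1_gt0 a12.
have K_ge0 : 0 <= 2 * (c2 / c1) * a2.
  by rewrite !mulr_ge0 // ?invr_ge0 ltW.
split.
- by rewrite ler_pdivlMr // mul1r.
- apply: le_trans (ler_wpM2l K_ge0 S_ge).
  (* Regrouped so that the factors bound $x_2$ and $1/x_1$ separately. *)
  have -> : 2 * (c2 / c1) * a2 / (2 * a1) = (c2 / (2 * a1)) * (2 * a2 / c1).
    by field; rewrite !gt_eqF.
  apply: ler_pM; rewrite ?invr_ge0 ?(ltW x1_gt0) //.
  + exact: le_trans (ltW x1_gt0) x12.
  + by rewrite ler_pdivlMr ?mulr_gt0 //; lra.
  + by rewrite -[leRHS]invf_div lef_pV2 ?posrE ?divr_gt0 ?mulr_gt0 //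
       ler_pdivrMr ?mulr_gt0 //; lra.
(* Once [S] is replaced by $n/(2a_1)$, the two sides are equal. *)
- apply: le_trans (ler_wpM2l K_ge0 S_le) _; rewrite le_eqVlt; apply/orP; left.
  by apply/eqP; field; rewrite !gt_eqF.
Qed.
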